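(* Let $\eta\in[0,2\pi)$ and let $G$ be a weakly connected mixed strongly regular graph with parameters $(n,k,\lambda,\mu)$, equipped with its $\eta$-function $\theta$. If $G$ is periodic, then $(n,k,\lambda,\mu)=(3\lambda,2\lambda,\lambda,2\lambda)$, $(n,k,\lambda,\mu)=(2k,k,0,k)$, $(n,k,\lambda,\mu)=(5,2,0,1)$, or $(n,k,\lambda,\mu)=(15,6,1,3)$.
   Context: A mixed graph $G=(V,\mathcal{A})$ consists of a finite vertex set $V$ and a subset $\mathcal{A} \subset V\times V \setminus \{(x,x) \mid x\in V\}$ of arcs. For an arc $a=(x,y)$, write $o(a)=x$, $t(a)=y$, $a^{-1}=(y,x)$. Let $\mathcal{A}^{-1}=\{a^{-1} \mid a\in\mathcal{A}\}$ and $\mathcal{A}^{\pm}=\mathcal{A}\cup\mathcal{A}^{-1}$. The underlying graph $G^{\pm}=(V,\mathcal{A}^{\pm})$ is regarded as an undirected simple graph; $G$ is weakly connected if $G^{\pm}$ is connected. Let $\deg_G x=\deg_{G^{\pm}}x$. An undirected graph is strongly regular with parameters $(n,k,\lambda,\mu)$ if it has $n$ vertices, is $k$-regular, is neither complete nor edgeless, any two adjacent vertices have exactly $\lambda$ common neighbours, and any two distinct non-adjacent vertices have exactly $\mu$ common neighbours. A mixed graph $G$ is a mixed strongly regular graph with parameters $(n,k,\lambda,\mu)$ if $G^{\pm}$ is a strongly regular graph with these parameters. The $\eta$-function $\theta:\mathcal{A}^{\pm}\to\mathbb{R}$ of $G$ is defined by $\theta(a)=\eta$ if $a\in\mathcal{A}\setminus\mathcal{A}^{-1}$,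 $\theta(a)=-\eta$ if $a\in\mathcal{A}^{-1}\setminus\mathcal{A}$, and $\theta(a)=0$ if $a\in\mathcal{A}\cap\mathcal{A}^{-1}$. Define $K\in\mathbb{C}^{V\times\mathcal{A}^{\pm}}$ by $K_{x,a}=\frac{1}{\sqrt{\deg_G x}}\delta_{x,t(a)}$, $C=2K^*K-I$, $(S_\theta)_{a,b}=e^{\theta(b)i}\delta_{a,b^{-1}}$ for $a,b\in\mathcal{A}^{\pm}$, and the time evolution matrix $U_\theta=S_\theta C\in\mathbb{C}^{\mathcal{A}^{\pm}\times\mathcal{A}^{\pm}}$. The mixed graph $G$ (equipped with $\theta$) is periodic if there is a positive integer $\tau$ with $U_\theta^{\tau}=I$. *)

(* Defs.v *)
From HB Require Import structures.
From mathcomp Require Import all_boot all_order all_algebra.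
From mathcomp Require Import complex.
From mathcomp Require Import reals trigo.

Set Implicit Arguments.
Unset Strict Implicit.
Unset Printing Implicit Defensive.

Import Order.TTheory GRing.Theory Num.Theory.

Local Open Scope ring_scope.
Local Open Scope complex_scope.
Local Open Scope sesquilinear_scope.

Record simple_graph (V : finType) := SimpleGraph {
  adj : rel V;
  adj_sym : symmetric adj;
  adj_irr : irreflexive adj
}.

Section SimpleGraph.
Variables (V : finType) (H : simple_graph V).

Definition nbrs (x : V) : {set V} := [set y | adj H x y].

Definition connected_graph : Prop := forall x y : V, connect (adj H) x y.

Definition complete_graph : Prop := forall x y : V, x != y -> adj H x y.

Definition edgeless_graph : Prop := forall x y : V, ~~ adj H x y.

Record strongly_regular (n k lam mu : nat) : Prop := StronglyRegular {
  srg_order : #|V| = n;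
  srg_regular : forall x : V, #|nbrs x| = k;
  srg_ncomplete : ~ complete_graph;
  srg_nedgeless : ~ edgeless_graph;
  srg_lambda : forall x y : V, adj H x y -> #|nbrs x :&: nbrs y| = lam;
  srg_mu : forall x y : V, x != y -> ~~ adj H x y -> #|nbrs x :&: nbrs y| = mu
}.

End SimpleGraph.

Record mixed_graph (V : finType) := MixedGraph {
  arcs : {set V * V};
  arcs_loopless : forall x : V, (x, x) \notin arcs
}.

Section MixedGraph.
Variables (V : finType) (G : mixed_graph V).

Definition terminus (a : V * V) : V := a.2.
Definition inv_arc (a : V * V) : V * V := (a.2, a.1).

Definition inv_arcs : {set V * V} := [set inv_arc a | a in arcs G].

Definition pm_arcs : {set V * V} := arcs G :|: inv_arcs.

Definition under_adj : rel V := [rel x y | (x, y) \in pm_arcs].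

Lemma mem_inv_arcs (a : V * V) : (a \in inv_arcs) = (inv_arc a \in arcs G).
Proof.
apply/imsetP/idP => [[[x y] xyA ->] //|aA].
by exists (inv_arc a) => //; case: a {aA}.
Qed.

Lemma under_sym : symmetric under_adj.
Proof.
by move=> x y; rewrite /under_adj /= !in_setU !mem_inv_arcs /inv_arc orbC.
Qed.

Lemma under_irr : irreflexive under_adj.
Proof.
move=> x; rewrite /under_adj /= in_setU mem_inv_arcs /inv_arc orbb.
exact/negbTE/arcs_loopless.
Qed.

Definition underlying : simple_graph V := SimpleGraph under_sym under_irr.

Definition weakly_connected : Prop := connected_graph underlying.

Definition mixed_strongly_regular (n k lam mu : nat) : Prop :=
  strongly_regular underlying n k lam mu.

Definition deg (x : V) : nat := #|nbrs underlying x|.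

(* Extended by 0 to the pairs of vertices that are not arcs; only the values
   on pm_arcs enter shift_mx. *)
Definition eta_fun (R : realType) (eta : R) (a : V * V) : R :=
  if a \in arcs G :\: inv_arcs then eta
  else if a \in inv_arcs :\: arcs G then - eta
  else 0.

End MixedGraph.

Definition expi (R : realType) (t : R) : R[i] := cos t +i* sin t.

(* Matrices indexed by V and by pm_arcs G are indexed through enum_val. *)
Section QuantumWalk.
Variables (R : realType) (V : finType) (G : mixed_graph V).

Local Notation pmA := (pm_arcs G).

Definition boundary_mx : 'M[R[i]]_(#|V|, #|pmA|) :=
  \matrix_(x, a) (((Num.sqrt (deg G (enum_val x))%:R : R)^-1)%:C
                  * (enum_val x == terminus (enum_val a))%:R).

Definition coin_mx : 'M[R[i]]_#|pmA| :=
  2%:R *: (boundary_mx ^t* *m boundary_mx) - 1%:M.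

Definition shift_mx (theta : V * V -> R) : 'M[R[i]]_#|pmA| :=
  \matrix_(a, b) (expi (theta (enum_val b))
                  * (enum_val a == inv_arc (enum_val b))%:R).

Definition evolution_mx (theta : V * V -> R) : 'M[R[i]]_#|pmA| :=
  shift_mx theta *m coin_mx.

Definition periodic_walk (theta : V * V -> R) : Prop :=
  exists2 tau : nat, (0 < tau)%N & evolution_mx theta ^+ tau = 1%:M.

End QuantumWalk.

(* Main.v *)
Require Import Defs.
From mathcomp Require Import all_boot all_order all_algebra.
From mathcomp Require Import complex.
From mathcomp Require Import reals trigo.
From mathcomp Require Import algC algnum separable cyclotomic.
From mathcomp Require Import zify ring.
Set Implicit Arguments.
Unset Strict Implicit.
Unset Printing Implicit Defensive.

Import Order.TTheory GRing.Theory Num.Theory.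
Local Open Scope ring_scope.

(** Two facts drive the proof: periodicity forces k to divide 2n, and a
    strongly regular graph has few parameters with that property.

    Divisibility.  Write U for the evolution matrix.  If U ^+ tau = 1, then U is
    diagonalizable and its eigenvalues are roots of unity, hence algebraic
    integers; so is their second elementary symmetric function e.  Newton's
    identity gives 2e = (tr U)^2 - tr U^2.  A walker needs two steps to come
    back to an arc, along that arc and its inverse, and the phases met on the
    way cancel because theta is odd under inversion.  Hence tr U = 0 and
    tr U^2 = nk (2/k - 1)^2, whatever eta is.  As nk is even,
    e = -(nk/2)(2/k - 1)^2 = -nk/2 + 2n - 2n/k,
    so the rational number 2n/k is an algebraic integer, that is, an integer
    ([periodic_regular_dvdn]).

    Parameters.  Counting paths of length two gives
    k^2 = k + k lam + (n - k - 1) mu; modulo k, this and k | 2n yield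
    k | 2 mu.  Since 0 < mu <= k, either mu = k, which leads to the two complete
    multipartite families, or k = 2 mu, which leads to
    (10 lam + 5, 4 lam + 2, lam, 2 lam + 1) ([srg_params_of_dvdn]).

    The last family.  Let D be the discriminant of the quadratic polynomial
    satisfied by the adjacency matrix off the all-one vector.  The projection
    onto one of its two eigenspaces has an integral trace, which gives
    m^2 D = t^2 for integers m and t ([srg_discriminant]).  In the family,
    t is nonzero as soon as lam > 0, so D = (lam + 5)^2 - 20 is then a
    square, which happens only for lam = 1 ([conference_family_lam_le1]).  The
    values lam = 0 and lam = 1 give (5, 2, 0, 1) and (15, 6, 1, 3). *)

(** * Algebraic integers and matrices of finite order *)

Section Integral.
Variable C : numClosedFieldType.
Local Notation integral := (integralOver (intr : int -> C)).

Lemma unity_root_integral (tau : nat) (x : C) :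
  (0 < tau)%N -> x ^+ tau = 1 -> integral x.
Proof.
move=> tau_gt0 xtau; exists ('X^tau - 1%:P); first exact: monicXnsubC.
by rewrite rmorphB /= map_polyXn map_polyC /= rootE !hornerE xtau subrr.
Qed.

(** The root condition is transported from C to rat, and from there to algC,
    whose rational algebraic integers are known to be integers. *)
Lemma integral_ratr_int (q : rat) : integral (ratr q) -> q \is a Num.int.
Proof.
case=> p p_monic /eqP pq0.
have {pq0} root_q : root (map_poly (intr : int -> algC) p) (ratr q).
  have eq_map (D : numClosedFieldType) :
      (map_poly (intr : int -> D) p).[ratr q]
      = ratr (map_poly (intr : int -> rat) p).[q].
    rewrite -horner_map -map_poly_comp; congr (_.[_]).
    by apply: eq_map_poly => z /=; rewrite ratr_int.
  move: pq0; rewrite eq_map => /eqP; rewrite fmorph_eq0 => /eqP pq0.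
  by rewrite rootE eq_map pq0 rmorph0.
have: (ratr q : algC) \in Num.int.
  apply: Cint_rat_Aint; first exact: Crat_rat.
  apply: root_monic_Aint root_q _ _; first exact: monic_map.
  by apply/polyOverP => i; rewrite coef_map /= intr_int.
by case/intrP=> z /eqP; rewrite -ratr_int fmorph_eq => /eqP ->; rewrite intr_int.
Qed.

(** The term e is the second elementary symmetric function of s.  Newton's
    identity is stated with 2e, because dividing by 2 would lose integrality. *)
Lemma sqr_sum_integral (s : seq C) : {in s, forall x, integral x} ->
  integral (\sum_(x <- s) x) /\
  exists2 e, integral e &
    (\sum_(x <- s) x) ^+ 2 = \sum_(x <- s) x ^+ 2 + 2%:R * e.
Proof.
elim: s => [|x s IHs] int_s.
  rewrite !big_nil; split; first exact: integral0.
  by exists 0; [exact: integral0 | rewrite expr0n mulr0 addr0].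
have int_x : integral x by apply: int_s; rewrite mem_head.
have [|int_sum [e int_e De]] := IHs.
  by move=> y sy; apply: int_s; rewrite in_cons sy orbT.
rewrite !big_cons; split; first exact: integral_add.
exists (e + x * \sum_(y <- s) y); last by rewrite sqrrD De; ring.
by apply: integral_add => //; apply: integral_mul.
Qed.

(** 'X^tau - 1 has simple roots in characteristic 0, so U is diagonalizable; d
    lists its eigenvalues. *)
Lemma finite_order_traces n (U : 'M[C]_n) (tau : nat) :
  (0 < tau)%N -> U ^+ tau = 1%:M ->
  exists d : 'rV[C]_n,
    [/\ forall i, d 0 i ^+ tau = 1,
        \tr U = \sum_i d 0 i & \tr (U *m U) = \sum_i d 0 i ^+ 2].
Proof.
case: n U => [|n] U tau_gt0 Utau.
  by exists 0; split=> [[]||] //; rewrite /mxtrace !big_ord0.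
pose p : {poly C} := 'X^tau - 1.
have [rs Dp] := closed_field_poly_normal p.
have p_monic : p \is monic by apply: monicXnsubC.
rewrite (monicP p_monic) scale1r in Dp.
have uniq_rs : uniq rs.
  by rewrite -separable_prod_XsubC -Dp separable_Xn_sub_1 // pnatr_eq0 -lt0n.
have /diagonalizableP [P Punit /diagonalizable_forPex [d]] :
    exists2 rs, uniq rs & mxminpoly U %| \prod_(x <- rs) ('X - x%:P).
  exists rs => //; rewrite -Dp; apply: mxminpoly_min.
  by rewrite /p rmorphB rmorphXn rmorph1 /= horner_mx_X Utau subrr.
move/(simmxP Punit) => PU.
have PUj j : P *m U ^+ j = diag_mx (\row_i d 0 i ^+ j) *m P.
  elim: j => [|j IHj].
    rewrite expr0 mulmx1 -[LHS]mul1mx; congr (_ *m _).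
    by apply/matrixP=> i i'; rewrite !mxE expr0.
  rewrite exprSr mulmxA IHj -mulmxA PU mulmxA mulmx_diag; congr (diag_mx _ *m _).
  by apply/rowP => i; rewrite !mxE exprSr.
have trUj j : \tr (U ^+ j) = \sum_i d 0 i ^+ j.
  rewrite -[U ^+ j](mulKmx Punit) mxtrace_mulC PUj mulmxK // mxtrace_diag.
  by apply: eq_bigr => i _; rewrite mxE.
exists d; split=> [i||].
- have /(congr1 (mulmx^~ (invmx P))) := PUj tau.
  rewrite Utau mulmx1 mulmxV // mulmxK // => /matrixP /(_ i i).
  by rewrite !mxE eqxx !mulr1n.
- exact: (trUj 1%N).
- exact: (trUj 2%N).
Qed.

(** The factor 2 is what makes k divide 2n in the end, and not merely 4n. *)
Lemma half_trace_sqr_integral n (U : 'M[C]_n) (tau : nat) :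
  (0 < tau)%N -> U ^+ tau = 1%:M -> \tr U = 0 ->
  exists2 e, integral e & \tr (U *m U) = - (2%:R * e).
Proof.
move=> tau_gt0 Utau trU0.
have [d [d_tau trU ->]] := finite_order_traces tau_gt0 Utau.
have [x|_ [e int_e]] := @sqr_sum_integral [seq d 0 i | i : 'I_n].
  by case/mapP=> i _ ->; apply: unity_root_integral (d_tau i).
rewrite !big_image /= -trU trU0 expr0n /= => De.
by exists e => //; apply/eqP; rewrite -addr_eq0 -De.
Qed.

End Integral.

(** * Traces of the evolution matrix *)

Section Walk.
Variables (R : realType) (V : finType) (G : mixed_graph V).
Local Notation pmA := (pm_arcs G).
Local Notation C := R[i].
Local Open Scope complex_scope.

Lemma inv_arcK : involutive (@inv_arc V).
Proof. by case. Qed.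

Lemma mem_pm_inv (a : V * V) : (inv_arc a \in pmA) = (a \in pmA).
Proof. by case: a => x y; rewrite -![_ \in pmA]/(under_adj G _ _) under_sym. Qed.

Lemma pm_arc_neq (a : V * V) : a \in pmA -> (a.1 == a.2) = false.
Proof.
case: a => x y aA; apply/negbTE/eqP => /= Dx; move: aA.
by rewrite Dx -[_ \in _]/(under_adj G y y) under_irr.
Qed.

Lemma card_pm_arcs : #|pmA| = (\sum_x deg G x)%N.
Proof.
rewrite -sum1_card (eq_bigl (fun a => predT a.1 && under_adj G a.1 a.2)) //=; last first.
  by case=> x y.
rewrite -(pair_big_dep predT (under_adj G) (fun _ _ => 1%N)) /=.
apply: eq_bigr => x _; rewrite sum1_card; apply: eq_card => y.
by rewrite !inE.
Qed.

(** Handshake lemma: inversion pairs the arcs that increase the rank of the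
    vertex with those that decrease it. *)
Lemma pm_arcs_even : exists m, #|pmA| = (2 * m)%N.
Proof.
pose up (a : V * V) := (enum_rank a.1 < enum_rank a.2)%N.
pose P := [set a in pmA | up a].
exists #|P|; have card_invP := card_imset P (can_inj inv_arcK).
rewrite mul2n -addnn -{2}card_invP.
rewrite -[LHS](cardsID P); congr (_ + _)%N; apply: eq_card => a.
  by rewrite !inE; case: (a \in arcs G); case: (a \in inv_arcs G).
have -> : (a \in [set inv_arc x | x in P]) = (inv_arc a \in P).
  apply/imsetP/idP => [[b Pb ->]|Pa]; first by rewrite inv_arcK.
  by exists (inv_arc a); rewrite ?inv_arcK.
rewrite !inE -!in_setU -/pmA mem_pm_inv.
have [aA|] := boolP (a \in pmA); rewrite ?andbF // andbT.
rewrite /up /= -leqNgt leq_eqVlt.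
by rewrite (inj_eq val_inj) (inj_eq enum_rank_inj) eq_sym pm_arc_neq.
Qed.

Lemma eta_fun_inv (eta : R) (a : V * V) :
  eta_fun G eta (inv_arc a) = - eta_fun G eta a.
Proof.
rewrite /eta_fun !in_setD !mem_inv_arcs inv_arcK.
by case: (a \in arcs G); case: (inv_arc a \in arcs G); rewrite /= ?opprK ?oppr0.
Qed.

Lemma expiNr (t : R) : expi t * expi (- t) = 1.
Proof.
apply/eqP; rewrite eq_complex /= cosN sinN mulrN opprK -!expr2 cos2Dsin2 eqxx /=.
by rewrite mulrN [sin t * _]mulrC addNr.
Qed.

(** Inversion of arcs, transported to the indices of the rows of the matrices. *)
Definition rev_idx (a : 'I_#|pmA|) : 'I_#|pmA| :=
  enum_rank_in (enum_valP a) (inv_arc (enum_val a)).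

Lemma enum_val_rev a : enum_val (rev_idx a) = inv_arc (enum_val a).
Proof. by rewrite /rev_idx enum_rankK_in // mem_pm_inv enum_valP. Qed.

Lemma eq_rev_idx a b : (enum_val a == inv_arc (enum_val b)) = (b == rev_idx a).
Proof.
by rewrite -(inj_eq enum_val_inj) enum_val_rev -(can_eq inv_arcK) inv_arcK eq_sym.
Qed.

Variables (theta : V * V -> R) (k : nat).
Hypothesis regG : forall x, deg G x = k.

Lemma boundary_mxE x a : boundary_mx R G x a =
  ((Num.sqrt k%:R)^-1)%:C * (enum_val x == (enum_val a).2)%:R.
Proof. by rewrite mxE regG. Qed.

Lemma coin_mxE a b : coin_mx R G a b =
  2%:R / k%:R * ((enum_val a).2 == (enum_val b).2)%:R - (a == b)%:R.
Proof.
rewrite !mxE; congr (_ - _); rewrite -mulrA; congr (_ * _).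
rewrite (bigD1 (enum_rank (enum_val a).2)) //= big1 ?addr0 => [|x x_neq].
  rewrite mxE mxE !boundary_mxE !enum_rankK eqxx mulr1 mulrA; congr (_ * _).
  have -> x : Num.conj (x%:C : C) = x%:C by exact: conjc_real.
  rewrite -rmorphM /= -invfM -expr2 sqr_sqrtr ?ler0n //.
  by rewrite fmorphV rmorph_nat.
rewrite mxE mxE boundary_mxE.
have /negbTE-> : enum_val x != (enum_val a).2.
  by apply: contraNneq x_neq => <-; rewrite enum_valK.
by rewrite mulr0 rmorph0 mul0r.
Qed.

Lemma evolution_mxE a b : evolution_mx G theta a b =
  expi (theta (inv_arc (enum_val a))) *
  (2%:R / k%:R * ((enum_val a).1 == (enum_val b).2)%:R - (b == rev_idx a)%:R).
Proof.
rewrite mxE (bigD1 (rev_idx a)) //= big1 ?addr0 => [|c c_neq].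
  by rewrite mxE coin_mxE enum_val_rev inv_arcK eqxx mulr1 [b == _]eq_sym.
by rewrite mxE eq_rev_idx (negbTE c_neq) mulr0 mul0r.
Qed.

Lemma trace_evolution : \tr (evolution_mx G theta) = 0.
Proof.
rewrite /mxtrace big1 // => a _; rewrite evolution_mxE.
have ends_neq := pm_arc_neq (enum_valP a).
rewrite ends_neq -(inj_eq enum_val_inj) enum_val_rev.
have /negbTE-> : enum_val a != inv_arc (enum_val a).
  by apply: contraFneq ends_neq => /(congr1 fst) /= ->.
by rewrite mulr0 subr0 mulr0.
Qed.

(** A step from b to a requires b to end where a starts, so steps in both
    directions force b = a^-1; then the phases at a and b are opposite. *)
Lemma trace_evolution_sqr :
  (forall a, theta (inv_arc a) = - theta a) ->
  \tr (evolution_mx G theta *m evolution_mx G theta)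
  = #|pmA|%:R * (2%:R / k%:R - 1) ^+ 2.
Proof.
move=> theta_inv; rewrite /mxtrace.
rewrite (eq_bigr (fun=> (2%:R / k%:R - 1) ^+ 2)) => [|a _].
  by rewrite sumr_const card_ord [RHS]mulr_natl.
rewrite mxE (bigD1 (rev_idx a)) //= big1 ?addr0 => [|b b_neq].
  rewrite !evolution_mxE !enum_val_rev /= !inv_arcK !eqxx.
  have -> : a == rev_idx (rev_idx a).
    by rewrite -(inj_eq enum_val_inj) !enum_val_rev inv_arcK.
  rewrite theta_inv !mulr1 mulrACA [X in X * _]mulrC expiNr mul1r expr2.
  by [].
have neq_ba : (enum_val b == inv_arc (enum_val a)) = false.
  by rewrite -(can_eq inv_arcK) inv_arcK eq_sym eq_rev_idx (negbTE b_neq).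
rewrite !evolution_mxE (negbTE b_neq) -[a == _]eq_rev_idx neq_ba !subr0.
move: neq_ba; rewrite /inv_arc [enum_val b]surjective_pairing xpair_eqE /=.
rewrite [(enum_val a).1 == _]eq_sym andbC.
by case: (_.2 == _.1) => /= [->|_]; rewrite !mulr0 ?mul0r.
Qed.

End Walk.

(** The half trace of U^2 is an algebraic integer, and it exceeds 2n/k by
    nk/2 - 2n, an integer by the handshake lemma. *)
Lemma periodic_regular_dvdn (R : realType) (V : finType) (G : mixed_graph V)
    (theta : V * V -> R) (k : nat) :
  (0 < k)%N -> (forall x, deg G x = k) ->
  (forall a, theta (inv_arc a) = - theta a) ->
  periodic_walk G theta -> (k %| 2 * #|V|)%N.
Proof.
move=> k_gt0 regG theta_inv [tau tau_gt0 Utau].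
have [e int_e] := half_trace_sqr_integral tau_gt0 Utau (trace_evolution theta regG).
rewrite (trace_evolution_sqr regG theta_inv) => De.
have [m Dm] := pm_arcs_even G.
have nk : (2 * m = #|V| * k)%N.
  by rewrite -Dm card_pm_arcs (eq_bigr (fun=> k)) ?sum_nat_const.
have k_neq0 : k%:R != 0 :> R[i] by rewrite pnatr_eq0 -lt0n.
have mE : m%:R = #|V|%:R * k%:R / 2%:R :> R[i].
  by rewrite -natrM -nk natrM mulrC mulKf // pnatr_eq0.
suff q_int : integralOver intr (ratr ((2 * #|V|)%:R / k%:R) : R[i]).
  have /intrP [z /eqP] := integral_ratr_int q_int.
  rewrite eq_sym -(inj_eq (mulIf (_ : k%:R != 0))) ?pnatr_eq0 -?lt0n //.
  rewrite mulfVK ?pnatr_eq0 -?lt0n // => Dz.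
  have {}Dz : z * k%:Z = (2 * #|V|)%:Z.
    by apply/eqP; rewrite -(eqr_int rat) rmorphM /= -!pmulrn; exact: Dz.
  by have : (k%:Z %| (2 * #|V|)%:Z)%Z by apply/dvdzP; exists z.
have -> : ratr ((2 * #|V|)%:R / k%:R) = (2 * #|V|)%:R - m%:R - e :> R[i].
  rewrite fmorph_div !rmorph_nat.
  have e_def : e = - (m%:R * (2%:R / k%:R - 1) ^+ 2).
    apply: (mulfI (_ : 2%:R != 0 :> R[i])); first by rewrite pnatr_eq0.
    by rewrite -[LHS]opprK -De Dm natrM; ring.
  rewrite e_def mE natrM; field.
  by rewrite k_neq0.
apply: integral_sub => //; apply: integral_sub; exact: integral_nat.
Qed.

(** * Strongly regular graphs *)

(** A rank factorization E = C R of an idempotent satisfies R C = 1. *)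
Lemma idempotent_trace (F : fieldType) n (E : 'M[F]_n) :
  E *m E = E -> \tr E = (\rank E)%:R.
Proof.
move=> EE; rewrite -{1}[E]mulmx_base mxtrace_mulC.
suff -> : row_base E *m col_base E = 1%:M by rewrite mxtrace1.
apply: (row_full_inj (col_base_full E)); apply: (row_free_inj (row_base_free E)).
by rewrite mulmx1 mulmx_base mulmxA mulmx_base -mulmxA mulmx_base.
Qed.

Section StronglyRegular.
Variables (V : finType) (H : simple_graph V) (n k lam mu : nat).
Hypothesis srg : strongly_regular H n k lam mu.

Lemma srg_adjacent_pair : exists x y, adj H x y.
Proof.
have [/existsP [x /existsP [y xy]]|] := boolP [exists x, exists y, adj H x y].
  by exists x, y.
rewrite negb_exists => /forallP noE; case: (srg_nedgeless srg) => x y.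
by have := noE x; rewrite negb_exists => /forallP.
Qed.

Lemma srg_nonadjacent_pair : exists x y, x != y /\ ~~ adj H x y.
Proof.
have [/existsP [x /existsP [y /andP [xy nxy]]]|] :=
  boolP [exists x, exists y, (x != y) && ~~ adj H x y]; first by exists x, y.
rewrite negb_exists => /forallP noN; case: (srg_ncomplete srg) => x y xy.
have := noN x; rewrite negb_exists => /forallP/(_ y).
by rewrite xy negbK.
Qed.

Lemma srg_lam_lt : (lam < k)%N.
Proof.
have [x [y xy]] := srg_adjacent_pair.
rewrite -(srg_lambda srg xy) -(srg_regular srg x); apply: proper_card.
apply/properP; split; first exact: subsetIl.
by exists y; rewrite !inE ?adj_irr ?andbF.
Qed.

Lemma srg_mu_le : (mu <= k)%N.
Proof.
have [x [y [xy nxy]]] := srg_nonadjacent_pair.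
by rewrite -(srg_mu srg xy nxy) -(srg_regular srg x) subset_leq_card ?subsetIl.
Qed.

(** Two non-adjacent vertices lie outside the union of their neighbourhoods. *)
Lemma srg_order_ge : (2 * k + 2 <= n + mu)%N.
Proof.
have [x [y [xy nxy]]] := srg_nonadjacent_pair.
rewrite -(srg_mu srg xy nxy) mul2n -addnn -{1}(srg_regular srg x).
rewrite -(srg_regular srg y) -cardsUI addnAC leq_add2r -(srg_order srg).
rewrite -(cardsC (nbrs H x :|: nbrs H y)) leq_add2l.
have -> : 2%N = #|[set x; y]| by rewrite cards2 xy.
apply/subset_leq_card/subsetP => z; rewrite !inE => /pred2P [] ->.
  by rewrite adj_irr adj_sym (negbTE nxy).
by rewrite adj_irr (negbTE nxy).
Qed.

(** If mu were 0, then adjacency would be transitive up to equality, and a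
    connected graph with this property is complete. *)
Lemma srg_mu_gt0 : connected_graph H -> (0 < mu)%N.
Proof.
move=> conn; rewrite lt0n; apply/eqP => mu0.
have adj_trans x y z : adj H x y -> adj H y z -> x != z -> adj H x z.
  move=> xy yz xz; apply/negPn/negP => /(srg_mu srg xz)/eqP.
  rewrite mu0 cards_eq0 => /eqP/setP/(_ y).
  by rewrite !inE xy adj_sym yz.
case: (srg_ncomplete srg) => x y.
have /connectP [p xp ->] := conn x y => {y}.
elim/last_ind: p xp => [|p z IHp]; first by rewrite eqxx.
rewrite rcons_path last_rcons => /andP [/IHp{}IHp pz xz].
have [Dx|/IHp xy] := eqVneq x (last x p); first by rewrite [x in adj H x _]Dx.
exact: adj_trans xy pz xz.
Qed.

(** Both sides count the paths of length two from a fixed vertex: by their middle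
    vertex on the left, by their last vertex on the right. *)
Lemma srg_count : (k * k = k + k * lam + (n - k.+1) * mu)%N.
Proof.
have [x _] := srg_adjacent_pair.
pose N := nbrs H.
have <- : (\sum_y #|N x :&: N y| = k * k)%N.
  rewrite -{1}(srg_regular srg x) -sum_nat_const.
  rewrite (eq_bigr (fun y => \sum_(z in N x) (z \in N y))%N) => [|y _]; last first.
    rewrite -sum1_card (eq_bigl _ _ (fun z => in_setI z (N x) (N y))) big_mkcondr.
    by apply: eq_bigr => z _; case: (z \in N y).
  rewrite exchange_big /=; apply: eq_bigr => z _.
  rewrite -(srg_regular srg z) -sum1_card [RHS]big_mkcond /=.
  by apply: eq_bigr => y _; rewrite !inE adj_sym; case: (adj H z y).
rewrite (bigID (mem (N x))) /= addnC (bigD1 x) ?inE ?adj_irr //= setIid (srg_regular srg).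
rewrite addnAC; congr (_ + _ + _)%N.
  rewrite (eq_bigr (fun=> lam)) ?sum_nat_const ?(srg_regular srg) //.
  by move=> y; rewrite inE => /(srg_lambda srg).
rewrite (eq_bigr (fun=> mu)) => [|y]; last first.
  rewrite inE => /andP [nxy yx]; apply: (srg_mu srg) => //; by rewrite eq_sym.
rewrite sum_nat_const; congr (_ * _)%N.
rewrite -(srg_order srg) -(srg_regular srg x) subnS -(cardsC (N x)) addKn.
rewrite [#|~: _|](cardD1 x) !inE adj_irr /=; apply: eq_card => y.
by rewrite unfold_in !inE andbC.
Qed.

Section Eigenvalues.
Variable F : rcfType.

Definition adj_mx : 'M[F]_#|V| :=
  \matrix_(i, j) (adj H (enum_val i) (enum_val j))%:R.
Local Notation A := adj_mx.
Local Notation J := (const_mx 1 : 'M[F]_#|V|).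

Lemma sum_adj x : \sum_(i < #|V|) (adj H x (enum_val i))%:R = k%:R :> F.
Proof.
rewrite -(srg_regular srg x) -natr_sum -[#|nbrs H x|]sum1_card; congr _%:R.
rewrite (reindex _ (onW_bij _ (@enum_rank_bij V))) [RHS]big_mkcond.
by apply: eq_bigr => y _; rewrite enum_rankK inE; case: (adj H x y).
Qed.

Lemma adj_mxJ : A *m J = k%:R *: J.
Proof.
apply/matrixP => i j; rewrite !mxE mulr1 -(sum_adj (enum_val i)).
by apply: eq_bigr => l _; rewrite !mxE mulr1.
Qed.

Lemma mul_J_adj_mx : J *m A = k%:R *: J.
Proof.
apply/matrixP => i j; rewrite !mxE mulr1 -(sum_adj (enum_val j)).
by apply: eq_bigr => l _; rewrite !mxE mul1r adj_sym.
Qed.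

Lemma mul_JJ : J *m J = n%:R *: J.
Proof.
apply/matrixP => i j; rewrite !mxE mulr1.
under eq_bigr do rewrite !mxE mulr1.
by rewrite sumr_const card_ord (srg_order srg).
Qed.

Lemma adj_mx_sqr :
  A *m A = (k%:R - mu%:R) *: 1%:M + (lam%:R - mu%:R) *: A + mu%:R *: J.
Proof.
apply/matrixP => i j; set x := enum_val i; set y := enum_val j.
have -> : (A *m A) i j = #|nbrs H x :&: nbrs H y|%:R.
  rewrite mxE -[#|_ :&: _|]sum1_card natr_sum.
  rewrite (reindex _ (onW_bij _ (@enum_rank_bij V))) [RHS]big_mkcond.
  apply: eq_bigr => z _; rewrite !mxE enum_rankK !inE -natrM mulnb.
  by rewrite [adj H z _]adj_sym; case: (_ && _).
rewrite !mxE -/x -/y -(inj_eq enum_val_inj) -/x -/y.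
have [<-|xy] := eqVneq x y.
  by rewrite setIid (srg_regular srg) adj_irr /=; ring.
have [Axy|Axy] := boolP (adj H x y); first by rewrite (srg_lambda srg Axy) /=; ring.
by rewrite (srg_mu srg xy Axy) /=; ring.
Qed.

Let d : F := mu%:R - lam%:R.

Lemma srg_countR :
  k%:R * k%:R = k%:R + k%:R * lam%:R + (n%:R - k%:R - 1) * mu%:R :> F.
Proof.
have kn : (k.+1 <= n)%N by have := srg_order_ge; have := srg_mu_le; lia.
have := congr1 (fun m => m%:R : F) srg_count.
by rewrite !natrD !natrM natrB // -natr1 opprD addrA.
Qed.

(** Off the all-one vector, A has the eigenvalues (- d + s) / 2 and
    (- d - s) / 2, with s^2 the discriminant.  The number r is the multiplicity
    of the first one, and the equation says that tr A = 0. *)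
Lemma srg_multiplicity (s : F) :
  s ^+ 2 = d ^+ 2 + 4%:R * (k%:R - mu%:R) -> s != 0 ->
  exists r : nat, s * (2%:R * r%:R - (n%:R - 1)) = d * (n%:R - 1) - 2%:R * k%:R.
Proof.
move=> s2 s_neq0.
have n_neq0 : n%:R != 0 :> F.
  have [x _] := srg_adjacent_pair.
  by rewrite pnatr_eq0 -(srg_order srg) -lt0n; apply/card_gt0P; exists x.
(* E is the spectral projection of A for the eigenvalue (- d + s) / 2: a and b
   come from Lagrange interpolation, and c makes E kill the all-one vector. *)
pose a : F := (1 + d / s) / 2%:R; pose b : F := s^-1.
pose c : F := - (a + b * k%:R) / n%:R.
pose E := a *: 1%:M + b *: A + c *: J.
have a_eq : a * a + b * b * (k%:R - mu%:R) = a.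
  have -> : k%:R - mu%:R = (s ^+ 2 - d ^+ 2) / 4%:R by rewrite s2; field.
  by rewrite /a /b; field.
have b_eq : 2%:R * a * b + b * b * (lam%:R - mu%:R) = b.
  by rewrite /a /b /d; field.
have c_eq : 2%:R * a * c + b * b * mu%:R + 2%:R * b * c * k%:R + c * c * n%:R = c.
  have cn : c * n%:R = - (a + b * k%:R) by rewrite /c mulfVK.
  suff : (a + b * k%:R - 1) * (c * n%:R) + b * b * (n%:R * mu%:R) = 0.
    move=> eq0; apply: (mulIf n_neq0).
    transitivity (c * n%:R + ((a + b * k%:R - 1) * (c * n%:R) + b * b * (n%:R * mu%:R))
      + c * n%:R * (c * n%:R + (a + b * k%:R))); first by ring.
    by rewrite eq0 {3}cn addNr mulr0 !addr0.
  have n_mu : n%:R * mu%:R = k%:R * k%:R - (lam%:R - mu%:R) * k%:R - (k%:R - mu%:R) :> F.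
    by rewrite srg_countR; ring.
  rewrite cn n_mu.
  transitivity (- (a * a + b * b * (k%:R - mu%:R)) + a
    - k%:R * (2%:R * a * b + b * b * (lam%:R - mu%:R)) + k%:R * b); first by ring.
  by rewrite a_eq b_eq; ring.
have EE : E *m E = E.
  rewrite /E !(mulmxDl, mulmxDr) -!scalemxAl -!scalemxAr !(mul1mx, mulmx1).
  rewrite adj_mxJ mul_J_adj_mx mul_JJ adj_mx_sqr.
  transitivity ((a * a + b * b * (k%:R - mu%:R)) *: 1%:M
    + (2%:R * a * b + b * b * (lam%:R - mu%:R)) *: A
    + (2%:R * a * c + b * b * mu%:R + 2%:R * b * c * k%:R + c * c * n%:R) *: J).
    by apply/matrixP=> i j; rewrite !mxE; ring.
  by rewrite a_eq b_eq c_eq.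
exists (\rank E).
have <- : \tr E = (\rank E)%:R := idempotent_trace EE.
have -> : \tr E = a * n%:R + c * n%:R.
  have trA : \tr A = 0 by rewrite /mxtrace big1 // => i _; rewrite mxE adj_irr.
  have trJ : \tr J = n%:R.
    rewrite /mxtrace; under eq_bigr do rewrite mxE.
    by rewrite sumr_const card_ord (srg_order srg).
  by rewrite !mxtraceD !mxtraceZ mxtrace1 trA trJ -(srg_order srg) mulr0 addr0.
rewrite /c mulfVK // /a /b; field.
by rewrite s_neq0.
Qed.

End Eigenvalues.

(** Squaring [srg_multiplicity] eliminates the irrational number s; the real
    closed field R only provides this square root. *)
Lemma srg_discriminant (R : rcfType) : (mu < k)%N ->
  exists m : int,
    m ^+ 2 * ((mu%:Z - lam%:Z) ^+ 2 + 4 * (k%:Z - mu%:Z))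
    = ((mu%:Z - lam%:Z) * (n%:Z - 1) - 2 * k%:Z) ^+ 2.
Proof.
move=> mu_lt.
pose D := (mu%:Z - lam%:Z) ^+ 2 + 4 * (k%:Z - mu%:Z).
have D_gt0 : 0 < D by rewrite /D; nia.
have DR : D%:~R = (mu%:R - lam%:R) ^+ 2 + 4%:R * (k%:R - mu%:R) :> R.
  by rewrite /D; ring.
have D_gt0R : 0 < D%:~R :> R by rewrite ltr0z.
have [||r Dr] := @srg_multiplicity R (Num.sqrt D%:~R).
- by rewrite sqr_sqrtr ?DR // ltW // -DR.
- by rewrite sqrtr_eq0 -ltNge.
exists (2 * r%:Z - (n%:Z - 1)); rewrite -/D.
apply/eqP; rewrite -(eqr_int R) !(rmorphM, rmorphXn, rmorphB) /=.
rewrite -{1}(sqr_sqrtr (ltW D_gt0R)) mulrC -exprMn.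
by apply/eqP; congr (_ ^+ 2).
Qed.

End StronglyRegular.

(** For l > 0, the quotient q of the right-hand base by m satisfies
    q^2 = (l + 5)^2 - 20.  The gap between (l + 5)^2 and the next smaller square
    is odd, and the one after it is 4l + 16, which exceeds 20 when l > 1. *)
Lemma conference_family_lam_le1 (l m : nat) :
  (m ^ 2 * (l ^ 2 + 10 * l + 5) = (10 * l ^ 2 + 6 * l) ^ 2)%N -> (l <= 1)%N.
Proof.
case: l => [//|l]; set t := (10 * _ + _)%N => Dt.
have m_gt0 : (0 < m)%N by case: m Dt => // /esym/eqP; rewrite mul0n expn_eq0 /t; lia.
have /dvdnP [q Dq] : (m %| t)%N by rewrite -(@dvdn_pexp2r _ _ 2) // -Dt dvdn_mulr.
have : (l.+1 ^ 2 + 10 * l.+1 + 5 = q ^ 2)%N.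
  apply/eqP; rewrite -(eqn_pmul2l (_ : 0 < m ^ 2)%N) ?expn_gt0 ?m_gt0 //.
  by rewrite Dt Dq expnMn mulnC.
move=> {Dt Dq t} Dq.
have q_lt : (q < l + 6)%N by nia.
have [q_eq|q_le] : q = (l + 5)%N \/ (q <= l + 4)%N by lia.
  by move: Dq; rewrite q_eq; nia.
by nia.
Qed.

(** * Classification *)

(** Besides k | 2n, this uses only the path count and inequalities valid in
    every connected strongly regular graph.  The bound n + mu >= 2k + 2 serves
    to exclude (3 mu, 2 mu, (3 mu - 1) / 2, mu). *)
Lemma srg_params_of_dvdn (n k lam mu : nat) :
  (0 < mu)%N -> (mu <= k)%N -> (lam < k)%N -> (2 * k + 2 <= n + mu)%N ->
  (k * k = k + k * lam + (n - k.+1) * mu)%N -> (k %| 2 * n)%N ->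
  [\/ (n, k, lam, mu) = (3 * lam, 2 * lam, lam, 2 * lam)%N,
      (n, k, lam, mu) = (2 * k, k, 0, k)%N
    | (n, k, mu) = (10 * lam + 5, 4 * lam + 2, 2 * lam + 1)%N].
Proof.
move=> mu_gt0 mu_le lam_lt n_ge count /dvdnP [c Dn].
have {}count : (k * k + k * mu + mu = k + k * lam + n * mu)%N.
  have Dn' : (n = (n - k.+1) + k.+1)%N by lia.
  by rewrite count {2}Dn'; ring.
(* Multiply the path count by 2 and replace 2n by c k. *)
have /dvdnP [e De] : (k %| 2 * mu)%N.
  rewrite -(@dvdn_addr (k * (2 * k + 2 * mu))) ?dvdn_mulr //.
  have -> : (k * (2 * k + 2 * mu) + 2 * mu = k * (2 + 2 * lam + c * mu))%N.
    transitivity (2 * (k * k + k * mu + mu))%N; first by ring.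
    rewrite count; transitivity (2 * k + 2 * k * lam + (2 * n) * mu)%N; first by ring.
    by rewrite Dn; ring.
  exact: dvdn_mulr.
have [e1|e2] : e = 1%N \/ e = 2%N by nia.
- have Dk : k = (2 * mu)%N by lia.
  have {}count : (6 * mu = 2 * lam + n + 1)%N.
    by apply/eqP; rewrite -(eqn_pmul2l mu_gt0); apply/eqP; move: count; rewrite Dk; nia.
  have {}Dn : n = (c * mu)%N by nia.
  (* Now (6 - c) mu = 2 lam + 1: c = 4 fails by parity, and c = 3 by the lower
     bound on n. *)
  have [c5|[c4|c3]] : c = 5 \/ c = 4 \/ c = 3 by nia.
  + by apply: Or33; congr (_, _, _); nia.
  + by nia.
  + by nia.
- have Dk : k = mu by lia.
  have {}count : (2 * k = lam + n)%N.
    by apply/eqP; rewrite -(eqn_pmul2l mu_gt0); apply/eqP; move: count; rewrite Dk; nia.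
  (* Now 2 lam = (4 - c) k with lam < k. *)
  have [c4|c3] : c = 4 \/ c = 3 by nia.
  + by apply: Or32; congr (_, _, _, _); nia.
  + by apply: Or31; congr (_, _, _, _); nia.
Qed.

Theorem theorem6p2 (R : realType) (eta : R) (V : finType) (G : mixed_graph V)
    (n k lam mu : nat) :
  0 <= eta < 2%:R * pi ->
  weakly_connected G ->
  mixed_strongly_regular G n k lam mu ->
  periodic_walk G (eta_fun G eta) ->
  [\/ (n, k, lam, mu) = (3 * lam, 2 * lam, lam, 2 * lam)%N,
      (n, k, lam, mu) = (2 * k, k, 0, k)%N,
      (n, k, lam, mu) = (5, 2, 0, 1)%N
    | (n, k, lam, mu) = (15, 6, 1, 3)%N].
Proof.
move=> _ conn srg periodic.
have lam_lt := srg_lam_lt srg.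
have k_dvd : (k %| 2 * n)%N.
  rewrite -(srg_order srg).
  apply: (periodic_regular_dvdn _ _ (eta_fun_inv G eta) periodic).
    exact: leq_ltn_trans lam_lt.
  exact: srg_regular srg.
have [Dparams|Dparams|[Dn Dk Dmu]] := srg_params_of_dvdn (srg_mu_gt0 srg conn)
    (srg_mu_le srg) lam_lt (srg_order_ge srg) (srg_count srg) k_dvd.
- exact: Or41.
- exact: Or42.
have [|m Dm] := srg_discriminant srg R; first by lia.
have lam_le1 : (lam <= 1)%N.
  apply: (@conference_family_lam_le1 lam `|m|); apply/eqP; rewrite -eqz_nat; apply/eqP.
  move: Dm; rewrite Dn Dk Dmu; nia.
have [lam0|lam1] : lam = 0%N \/ lam = 1%N by lia.
- by apply: Or43; rewrite Dn Dk Dmu lam0.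
- by apply: Or44; rewrite Dn Dk Dmu lam1.
Qed.
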